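(* Let $r,k\in\mathbb{Z}$ and let $n\ge 0$ be an integer. Then, as polynomials in $x$, $$A_{n}^{(r,k)}(x)=\sum_{j=0}^{n}\left\{\sum_{l=0}^{n-j}\sum_{a=0}^{n-l-j}(-1)^{j}\binom{n}{l+j}\binom{n-l-j}{a}S_1(l+j,j)\,B_{a}^{(a-r+1)}(1)\,C_{n-j-l-a}^{(k)}\right\}x^{j}.$$
   Context: All generating functions are formal power series in $t$. For $k\in\mathbb{Z}$, put $\mathrm{Lif}_k(t)=\sum_{n\ge 0}\frac{t^n}{n!(n+1)^k}$. For $r,k\in\mathbb{Z}$, the polynomials $A_n^{(r,k)}(x)\in\mathbb{C}[x]$ are defined by $$\left(\frac{t}{\log(1+t)}\right)^{r}\frac{\mathrm{Lif}_k(\log(1+t))}{(1+t)^{x}}=\sum_{n\ge 0}A_n^{(r,k)}(x)\frac{t^n}{n!}.$$ The poly-Cauchy numbers $C_n^{(k)}$ are defined by $\mathrm{Lif}_k(\log(1+t))=\sum_{n\ge 0}C_n^{(k)}\frac{t^n}{n!}$. For $\alpha\in\mathbb{Z}$ (possibly negative or zero), the Bernoulli polynomials of order $\alpha$ are defined by $\left(\frac{t}{e^t-1}\right)^{\alpha}e^{xt}=\sum_{n\ge 0}B_n^{(\alpha)}(x)\frac{t^n}{n!}$; thus $B_a^{(a-r+1)}(1)$ is the value at $x=1$ of the $a$-th Bernoulli polynomial of order $a-r+1$. $S_1(n,m)$ is the (signed) Stirling number of the first kind: $x(x-1)\cdots(x-n+1)=\sum_{m=0}^n S_1(n,m)x^m$.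 *)

(* Defs.v *)
From HB Require Import structures.
From mathcomp Require Import all_boot all_order all_algebra.
From mathcomp Require Import boolp.

Set Implicit Arguments.
Unset Strict Implicit.
Unset Printing Implicit Defensive.

Import GRing.Theory.
Local Open Scope ring_scope.

(******************************************************************************)
(*            fps R == formal power series over R in one variable t           *)
(*              f n == the coefficient of t^n in f                            *)
(*          fps_t R == the variable t                                         *)
(*     fps_const a  == the constant series a                                  *)
(*     fps_comp g h == g(h(t)), for h with constant coefficient 0             *)
(*       fps_tdiv f == t / f(t), for f with constant coefficient 0 and        *)
(*                     invertible coefficient of t                            *)
(*  fps R is a commutative ring, in which f is a unit iff f 0 is a unit; the  *)
(*  integer powers f ^ r are those of the library (exprz).                    *)
(******************************************************************************)

Record fps (R : Type) := Fps { fps_coef :> nat -> R }.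

HB.instance Definition _ (R : Type) := gen_eqMixin (fps R).
HB.instance Definition _ (R : Type) := gen_choiceMixin (fps R).

Lemma fpsP (R : Type) (f g : fps R) : (forall n, f n = g n) -> f = g.
Proof. by case: f g => [f] [g] /= /funext ->. Qed.

Section FpsRing.
Variable R : comNzRingType.
Implicit Types f g h : fps R.

Definition fps_const (a : R) : fps R := Fps (fun n => if n == 0%N then a else 0).
Definition fps_add f g : fps R := Fps (fun n => f n + g n).
Definition fps_opp f : fps R := Fps (fun n => - f n).
Definition fps_mul f g : fps R := Fps (fun n => \sum_(i < n.+1) f i * g (n - i)%N).

Fact fps_addA : associative fps_add.
Proof. by move=> f g h; apply: fpsP => n /=; rewrite addrA. Qed.
Fact fps_addC : commutative fps_add.
Proof. by move=> f g; apply: fpsP => n /=; rewrite addrC. Qed.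
Fact fps_add0 : left_id (fps_const 0) fps_add.
Proof. by move=> f; apply: fpsP => n /=; rewrite if_same add0r. Qed.
Fact fps_addN : left_inverse (fps_const 0) fps_opp fps_add.
Proof. by move=> f; apply: fpsP => n /=; rewrite addNr if_same. Qed.

HB.instance Definition _ :=
  GRing.isZmodule.Build (fps R) fps_addA fps_addC fps_add0 fps_addN.

Let trunc m f : {poly R} := \poly_(i < m.+1) f i.

Let truncE m f n : (n <= m)%N -> (trunc m f)`_n = f n.
Proof. by move=> le_nm; rewrite coef_poly ltnS le_nm. Qed.

Let mulE m f g n : (n <= m)%N -> fps_mul f g n = (trunc m f * trunc m g)`_n.
Proof.
move=> le_nm; rewrite coefM; apply: eq_bigr => i _.
rewrite !truncE //; first exact: leq_trans (leq_subr _ _) le_nm.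
by apply: leq_trans le_nm; rewrite -ltnS.
Qed.

Fact fps_mulC : commutative fps_mul.
Proof. by move=> f g; apply: fpsP => n; rewrite !(@mulE n) // mulrC. Qed.
Fact fps_mulA : associative fps_mul.
Proof.
move=> f g h; apply: fpsP => n.
transitivity (trunc n f * (trunc n g * trunc n h))`_n.
  rewrite coefM; apply: eq_bigr => i _.
  by rewrite truncE; [rewrite (@mulE n) // leq_subr | rewrite -ltnS].
rewrite mulrA coefM; apply: eq_bigr => i _.
by rewrite truncE ?leq_subr //; congr (_ * _); rewrite (@mulE n) // -ltnS.
Qed.
Fact fps_mul1 : left_id (fps_const 1) fps_mul.
Proof.
move=> f; apply: fpsP => n /=.
by rewrite big_ord_recl /= mul1r subn0 big1 ?addr0 // => i _; rewrite mul0r.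
Qed.
Fact fps_mulDl : left_distributive fps_mul fps_add.
Proof.
move=> f g h; apply: fpsP => n /=; rewrite -big_split /=.
by apply: eq_bigr => i _; rewrite mulrDl.
Qed.
Fact fps_oner_neq0 : fps_const 1 != fps_const 0.
Proof.
by apply/eqP => /(congr1 (fun f : fps R => f 0%N)) /= /eqP; rewrite oner_eq0.
Qed.

HB.instance Definition _ := GRing.Zmodule_isComNzRing.Build (fps R)
  fps_mulA fps_mulC fps_mul1 fps_mulDl fps_oner_neq0.

Lemma fps0E n : (0 : fps R) n = 0.
Proof. exact: if_same. Qed.
Lemma fps1E n : (1 : fps R) n = (n == 0%N)%:R.
Proof. by rewrite /1 /=; case: eqP. Qed.
Lemma fpsDE f g n : (f + g) n = f n + g n.
Proof. by []. Qed.
Lemma fpsNE f n : (- f) n = - f n.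
Proof. by []. Qed.
Lemma fpsME f g n : (f * g) n = \sum_(i < n.+1) f i * g (n - i)%N.
Proof. by []. Qed.

Lemma fps_sumE (I : Type) (s : seq I) (P : pred I) (F : I -> fps R) n :
  (\sum_(i <- s | P i) F i) n = \sum_(i <- s | P i) F i n.
Proof. exact: (big_morph (fun f : fps R => f n) (fun _ _ => erefl) (fps0E n)). Qed.

Lemma fpsX_small f k n : f 0%N = 0 -> (n < k)%N -> (f ^+ k) n = 0.
Proof.
move=> f0; elim: k n => // k IHk n; rewrite ltnS => le_nk.
rewrite exprS fpsME big1 // => -[[|i] /= lt_in] _; first by rewrite f0 mul0r.
by rewrite IHk ?mulr0 //; apply: leq_trans le_nk; rewrite -subSn // subSS leq_subr.
Qed.

Definition fps_t : fps R := Fps (fun n => (n == 1%N)%:R).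

Definition fps_shift f : fps R := Fps (fun n => f n.+1).

Lemma fps_shiftK f : f 0%N = 0 -> fps_t * fps_shift f = f.
Proof.
move=> f0; apply: fpsP => -[|n]; rewrite fpsME.
  by rewrite big_ord_recl big_ord0 /= mul0r addr0 f0.
rewrite big_ord_recl /= mul0r add0r big_ord_recl /= mul1r.
by rewrite big1 ?addr0 => [|i _]; rewrite ?mul0r // /bump /= addn0 subSS subn0.
Qed.

(* The sum is finite because h ^+ k has no term of degree < k (fpsX_small). *)
Definition fps_comp (g h : fps R) : fps R :=
  Fps (fun n => \sum_(k < n.+1) g k * (h ^+ k) n).

End FpsRing.
Arguments fps_t R : clear implicits.

Section FpsUnitRing.
Variable R : comUnitRingType.
Implicit Types f g : fps R.

Definition fps_unit : pred (fps R) := fun f => f 0%N \is a GRing.unit.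

(* For a = f 0 invertible, 1/f = a^-1 * \sum_k (1 - a^-1 f)^k. *)
Definition fps_inv f : fps R :=
  if fps_unit f then
    fps_const (f 0%N)^-1 *
      fps_comp (Fps (fun=> 1)) (1 - fps_const (f 0%N)^-1 * f)
  else f.

Lemma fps_mul0E f g : (f * g) 0%N = f 0%N * g 0%N.
Proof. by rewrite fpsME big_ord_recl big_ord0 addr0. Qed.

Lemma fps_geometric f : f 0%N = 0 -> fps_comp (Fps (fun=> 1)) f * (1 - f) = 1.
Proof.
move=> f0; apply: fpsP => n.
transitivity (((\sum_(k < n.+1) f ^+ k) * (1 - f)) n).
  rewrite [LHS]fpsME fpsME; apply: eq_bigr => i _; congr (_ * _).
  have le_in : (i < n.+1)%N by [].
  rewrite fps_sumE /= (eq_bigr (fun k : 'I__ => (f ^+ k) i)); last first.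
    by move=> k _; rewrite mul1r.
  rewrite (big_ord_widen _ (fun k => (f ^+ k) i) le_in) big_mkcond /=.
  apply: eq_bigr => k _; case: ltnP => // lt_ik.
  by rewrite fpsX_small.
rewrite mulrC -opprB mulNr -subrX1 opprB.
by rewrite fpsDE fpsNE (@fpsX_small _ f) // subr0.
Qed.

Fact fps_mulVf : {in fps_unit, left_inverse 1 fps_inv *%R}.
Proof.
move=> f Uf; rewrite /fps_inv [fps_unit f]Uf.
set a := fps_const _; rewrite mulrAC -[f in a * f](subKr 1) mulrC.
rewrite subKr -[X in _ * X](subKr 1) fps_geometric //.
rewrite fpsDE fpsNE fps_mul0E fps1E /= mulVr ?subrr //.
Qed.

Fact fps_unitPl f g : g * f = 1 -> fps_unit f.
Proof.
move/(congr1 (fun h : fps R => h 0%N)); rewrite fps_mul0E fps1E /= => gf1.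
by apply/unitrP; exists (g 0%N); split; rewrite // mulrC.
Qed.

Fact fps_inv_out : {in [predC fps_unit], fps_inv =1 id}.
Proof. by move=> f; rewrite inE /fps_inv => /negbTE Uf; rewrite [fps_unit f]Uf. Qed.

HB.instance Definition _ := GRing.ComNzRing_hasMulInverse.Build (fps R)
  fps_mulVf fps_unitPl fps_inv_out.

Definition fps_tdiv f : fps R := (fps_shift f)^-1.

Lemma fps_tdivK f :
  f 0%N = 0 -> f 1%N \is a GRing.unit -> fps_tdiv f * f = fps_t R.
Proof.
move=> f0 f1; rewrite -[X in _ * X]fps_shiftK // mulrCA mulVr ?mulr1 //.
Qed.

End FpsUnitRing.

Section Sequences.
Variable F : numFieldType.
Implicit Types r k alpha : int.

(* p (p - 1) ... (p - n + 1) *)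
Definition falling (R : comNzRingType) (p : R) (n : nat) : R :=
  \prod_(i < n) (p - i%:R).

Definition stirling1 (n m : nat) : int := (falling ('X : {poly int}) n)`_m.

Definition fps_exp : fps F := Fps (fun n => (n`!%:R)^-1).

Definition fps_log1p : fps F :=
  Fps (fun n => if n is m.+1 then (-1) ^+ m / m.+1%:R else 0).

Definition fps_Lif k : fps F := Fps (fun n => (n`!%:R * n.+1%:R ^ k)^-1).

(* Series whose coefficients are polynomials in x = 'X. *)
Definition fps_polyC (f : fps F) : fps {poly F} := Fps (fun n => (f n)%:P).

(* exp(p t) and the binomial series (1 + t)^p *)
Definition fps_expM (p : {poly F}) : fps {poly F} :=
  Fps (fun n => (n`!%:R)^-1 *: p ^+ n).
Definition fps_1tX (p : {poly F}) : fps {poly F} :=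
  Fps (fun n => (n`!%:R)^-1 *: falling p n).

Definition polyA r k (n : nat) : {poly F} :=
  n`!%:R * (fps_polyC (fps_tdiv fps_log1p ^ r * fps_comp (fps_Lif k) fps_log1p)
            * fps_1tX (- 'X)) n.

Definition poly_cauchy k (n : nat) : F :=
  n`!%:R * fps_comp (fps_Lif k) fps_log1p n.

Definition bernoulli alpha (n : nat) : {poly F} :=
  n`!%:R * (fps_polyC (fps_tdiv (fps_exp - 1) ^ alpha) * fps_expM 'X) n.

Lemma fps_tdiv_log1pK : fps_tdiv fps_log1p * fps_log1p = fps_t F.
Proof. by rewrite fps_tdivK //= divr1 unitr1. Qed.

Lemma fps_tdiv_expm1K : fps_tdiv (fps_exp - 1) * (fps_exp - 1) = fps_t F.
Proof.
by rewrite fps_tdivK // fpsDE fpsNE fps1E /= invr1 ?subrr ?subr0 ?unitr1.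
Qed.

End Sequences.

(* Main.v *)
(* Expanding [(1 + t)^(-x)] by Stirling numbers reduces the theorem to
   [[t^a] (t / log(1 + t))^r = [t^a] (t / (e^t - 1))^(a - r + 1) e^t].
   This is the substitution [u = e^t - 1], [du = e^t dt] in the residue of
   [u^(-a-1) (u / log(1 + u))^r du].  In terms of power series, for [h] with
   [h(0) = 0] and [h'(0)] invertible, the substitution rule reads
   [[t^a] f = [t^a] f(h(t)) h'(t) (t / h(t))^(a+1)]; by linearity it is enough
   to check it for [f = t^k], where it says that a derivative has no residue. *)
Require Import Defs.
From mathcomp Require Import all_boot all_order all_algebra.
From mathcomp Require Import reals complex ring.

Set Implicit Arguments.
Unset Strict Implicit.
Unset Printing Implicit Defensive.

Import GRing.Theory.
Local Open Scope ring_scope.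

(** Reindexing by m = l + j. It serves for products under composition and, at the end, for
    collecting powers of x. *)
Lemma sum_triangle (V : nmodType) N (T : nat -> nat -> V) :
  \sum_(m < N) \sum_(j < m.+1) T m j =
  \sum_(j < N) \sum_(l < N - j) T (l + j)%N j.
Proof.
under eq_bigr => m _ do rewrite (big_ord_widen N (T m) (ltn_ord m)).
rewrite (exchange_big_dep predT) //=; apply: eq_bigr => j _.
rewrite -(big_mkord (fun m => (j < m.+1)%N) (T^~ j)).
rewrite -(big_mkord xpredT (fun l => T (l + j)%N j)).
rewrite (big_cat_nat (n := j)) ?(ltnW (ltn_ord j)) //=.
rewrite big_nat_cond big1 ?add0r; last first.
  by move=> m /andP[/andP[_ lt_mj]]; rewrite ltnS leqNgt lt_mj.
rewrite -{1}[j : nat]add0n big_addn; apply: congr_big_nat => // l _.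
by rewrite ltnS leq_addl.
Qed.

(** * Formal derivative of a power series *)

Section Derivative.
Variable R : comNzRingType.
Implicit Types f g h : fps R.

Definition fps_deriv f : fps R := Fps (fun n => f n.+1 *+ n.+1).

Lemma fps_derivE f n : fps_deriv f n = f n.+1 *+ n.+1.
Proof. by []. Qed.

Lemma fpsMnE f m n : (f *+ m) n = f n *+ m.
Proof. by elim: m => [|m IHm]; rewrite ?fps0E // !mulrS fpsDE IHm. Qed.

Lemma fps_tME f n : (fps_t R * f) n.+1 = f n.
Proof.
rewrite fpsME big_ord_recl /= mul0r add0r big_ord_recl /= mul1r.
by rewrite big1 ?addr0 => [|i _]; rewrite ?mul0r // /bump /= addn0 subSS subn0.
Qed.

Lemma fps_tXME f k n : (fps_t R ^+ k * f) (n + k)%N = f n.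
Proof.
elim: k => [|k IHk]; first by rewrite mul1r addn0.
by rewrite exprS -mulrA addnS fps_tME.
Qed.

Lemma fps_deriv_t : fps_deriv (fps_t R) = 1.
Proof. by apply: fpsP => -[|n]; rewrite fps_derivE fps1E //= mul0rn. Qed.

Lemma fps_derivM f g :
  fps_deriv (f * g) = fps_deriv f * g + f * fps_deriv g.
Proof.
apply: fpsP => n; rewrite fps_derivE fpsDE !fpsME -sumrMnl.
(* The weight n + 1 is split as i + (n + 1 - i); the first sum then loses its term i = 0, the second
   its term i = n + 1. *)
rewrite (eq_bigr (fun i : 'I_n.+2 => (f i *+ i) * g (n.+1 - i)%N
                         + f i * (g (n.+1 - i)%N *+ (n.+1 - i)))); last first.
  move=> i _; rewrite mulrnAl mulrnAr -mulrnDr subnKC //.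
  by rewrite -ltnS ltn_ord.
rewrite big_split /=; congr (_ + _).
  by rewrite big_ord_recl mulr0n mul0r add0r; apply: eq_bigr => i _.
rewrite big_ord_recr /= subnn mulr0n mulr0 addr0.
by apply: eq_bigr => i _; rewrite subSn // -ltnS ltn_ord.
Qed.

Lemma fps_derivX f n : fps_deriv (f ^+ n.+1) = f ^+ n * fps_deriv f *+ n.+1.
Proof.
elim: n => [|n IHn]; first by rewrite mul1r.
rewrite exprS fps_derivM IHn exprS; ring.
Qed.

End Derivative.

(** * Composition with a series without constant term *)

Section Composition.
Variable R : comNzRingType.
Variable h : fps R.
Hypothesis h0 : h 0%N = 0.
Implicit Types f g : fps R.

Lemma fps_comp_widen f n N : (n < N)%N ->
  fps_comp f h n = \sum_(k < N) f k * (h ^+ k) n.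
Proof.
move=> lt_nN; rewrite /= (big_ord_widen _ (fun k => f k * (h ^+ k) n) lt_nN).
rewrite big_mkcond; apply: eq_bigr => k _; case: ltnP => // lt_nk.
by rewrite fpsX_small // mulr0.
Qed.

(** Linearity in [f], with one bound [N] for all coefficients involved; this is what later reduces
    the substitution rule to powers of t. *)
Lemma fps_comp_mulE f g n N : (n < N)%N ->
  (fps_comp f h * g) n = \sum_(k < N) f k * (h ^+ k * g) n.
Proof.
move=> lt_nN; rewrite fpsME (eq_bigr (fun i : 'I_n.+1 =>
  \sum_(k < N) f k * (h ^+ k) i * g (n - i)%N)); last first.
  move=> i _; rewrite (@fps_comp_widen f i N) ?mulr_suml //.
  exact: leq_trans lt_nN.
rewrite exchange_big; apply: eq_bigr => k _.
by rewrite fpsME mulr_sumr; apply: eq_bigr => i _; rewrite mulrA.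
Qed.

Lemma fps_compD f g : fps_comp (f + g) h = fps_comp f h + fps_comp g h.
Proof.
apply: fpsP => n; rewrite fpsDE /= -big_split.
by apply: eq_bigr => k _; rewrite mulrDl.
Qed.

Lemma fps_comp1 : fps_comp 1 h = 1.
Proof.
apply: fpsP => n; rewrite /= big_ord_recl big1 ?addr0 ?mul1r // => k _.
by rewrite mul0r.
Qed.

Lemma fps_comp_t : fps_comp (fps_t R) h = h.
Proof.
apply: fpsP => n; rewrite (@fps_comp_widen _ _ n.+2) //.
rewrite !big_ord_recl big1 /= => [|k _]; last by rewrite mul0r.
by rewrite mul0r add0r addr0 mul1r.
Qed.

(** Both sides sum f_i g_l h^(i+l), over the triangle i + l <= n on the left and over a square on
    the right. The surplus terms vanish, since h^(i+l) then has no term of degree n. *)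
Lemma fps_compM f g : fps_comp (f * g) h = fps_comp f h * fps_comp g h.
Proof.
apply: fpsP => n; rewrite (@fps_comp_mulE f _ n n.+1) //.
under [RHS]eq_bigr => i _.
  rewrite [h ^+ _ * _]mulrC (@fps_comp_mulE _ _ n n.+1) // mulr_sumr.
  under eq_bigr => k _ do rewrite -exprD.
  over.
rewrite (@fps_comp_widen _ n n.+1) //.
under [LHS]eq_bigr => m _ do rewrite fpsME mulr_suml.
rewrite (sum_triangle n.+1 (fun m i => f i * g (m - i)%N * (h ^+ m) n)).
apply: eq_bigr => i _.
rewrite (big_ord_widen n.+1
  (fun l => f i * g (l + i - i)%N * (h ^+ (l + i)) n));
  last exact: leq_subr.
rewrite big_mkcond; apply: eq_bigr => l _; case: ltnP => [_|le_nl].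
  by rewrite addnK mulrA.
by rewrite fpsX_small ?mulr0 // addnC -leq_subLR.
Qed.

Lemma fps_deriv_comp f :
  fps_deriv (fps_comp f h) = fps_comp (fps_deriv f) h * fps_deriv h.
Proof.
apply: fpsP => n; rewrite (@fps_comp_mulE _ _ n n.+1) // fps_derivE.
rewrite -sumrMnl big_ord_recl fps1E mulr0 mul0rn add0r.
apply: eq_bigr => k _; rewrite [fps_deriv f k]fps_derivE mulrnAl -!mulrnAr.
by congr (_ * _); rewrite -fps_derivE fps_derivX fpsMnE.
Qed.

End Composition.

(** * Residues and the substitution rule *)

Section ChangeOfVariable.
Variable F : numFieldType.
Variable h : fps F.
Hypothesis h0 : h 0%N = 0.
Hypothesis h1 : h 1%N != 0.
Implicit Types f : fps F.

Let V := fps_tdiv h.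

Let Vh : V * h = fps_t F.
Proof. by rewrite fps_tdivK ?unitfE. Qed.

(** This is the residue of h' / h^(s+1): a logarithmic derivative for s = 0, the derivative of
    -h^(-s)/s otherwise. Powers of [V] = t/h replace negative powers of [h]. *)
Lemma fps_residue_deriv s : (fps_deriv h * V ^+ s.+1) s = (s == 0%N)%:R.
Proof.
have dVh : fps_deriv V * h + V * fps_deriv h = 1.
  by rewrite -fps_derivM Vh fps_deriv_t.
have -> : fps_deriv h * V ^+ s.+1 = V ^+ s * (1 - fps_deriv V * h).
  by rewrite -dVh exprS; ring.
case: s => [|s]; first by rewrite mul1r fpsDE fpsNE fps_mul0E h0 mulr0 subr0.
(* The subtracted term is t (V^(s+1))' / (s+1), whose coefficient at degree s+1 is that of V^(s+1);
   cancelling s+1 uses characteristic 0. *)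
have -> : V ^+ s.+1 * (1 - fps_deriv V * h) =
          V ^+ s.+1 - fps_t F * (V ^+ s * fps_deriv V).
  by rewrite -Vh exprS; ring.
rewrite fpsDE fpsNE fps_tME; apply/eqP; rewrite subr_eq0; apply/eqP.
have := congr1 (fun f : fps F => f s) (fps_derivX V s).
rewrite fps_derivE => dV; apply: (@mulIf _ s.+1%:R).
  by rewrite Num.Theory.pnatr_eq0.
by rewrite !mulr_natr dV fpsMnE.
Qed.

Lemma fps_change_of_variable f a :
  f a = (fps_comp f h * (fps_deriv h * V ^+ a.+1)) a.
Proof.
(* Since [V * h] = t, the product is t^k h' V^(a-k+1): the residue computation applies with s = a -
   k, and only k = a survives. *)
have hV k : (k <= a)%N ->
    (h ^+ k * (fps_deriv h * V ^+ a.+1)) a = (a - k == 0)%N%:R.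
  move=> le_ka.
  rewrite -fps_residue_deriv -(fps_tXME _ k (a - k)) subnK // -Vh.
  congr ((_ : fps F) _); rewrite -{1}(subnK le_ka) -addSn exprD exprMn; ring.
rewrite (@fps_comp_mulE _ _ h0 _ _ _ a.+1) // big_ord_recr big1 => [|k _].
  by rewrite hV //= subnn add0r mulr1.
by rewrite hV /= 1?ltnW // subn_eq0 leqNgt ltn_ord mulr0.
Qed.

End ChangeOfVariable.

(** * Integer powers under composition *)

Section IntegerPowers.
Variable R : comUnitRingType.
Variable h : fps R.
Hypothesis h0 : h 0%N = 0.
Implicit Types f : fps R.

Lemma fps_compX f n : fps_comp (f ^+ n) h = fps_comp f h ^+ n.
Proof.
by elim: n => [|n IHn]; rewrite ?fps_comp1 // !exprS fps_compM // IHn.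
Qed.

Lemma fps_compXz f (r : int) : f \is a GRing.unit ->
  fps_comp (f ^ r) h = fps_comp f h ^ r.
Proof.
case: r => n Uf; first exact: fps_compX.
(* For a negative exponent, composition is multiplicative and fixes 1, hence sends inverses to
   inverses. *)
rewrite !NegzE -!exprnN; apply/esym/mulr1_eq.
by rewrite -fps_compX -fps_compM // mulrV ?unitrX // fps_comp1.
Qed.

End IntegerPowers.

(** * The series log(1 + t) and e^t - 1 *)

Section LogExp.
Variable F : numFieldType.
Implicit Types f g : fps F.

Let natr_neq0 n : n.+1%:R != 0 :> F.
Proof. by rewrite Num.Theory.pnatr_eq0. Qed.

Let fact_neq0 n : n`!%:R != 0 :> F.
Proof. by rewrite Num.Theory.pnatr_eq0 -lt0n fact_gt0. Qed.

Lemma fps_deriv_inj f g : f 0%N = g 0%N -> fps_deriv f = fps_deriv g -> f = g.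
Proof.
move=> eq0 eqd; apply: fpsP => -[|n] //; apply: (mulIf (natr_neq0 n)).
by rewrite !mulr_natr -!fps_derivE eqd.
Qed.

(** Although t is not a unit, multiplying by it only shifts coefficients, so it can be cancelled. *)
Lemma fps_tI : injective ( *%R (fps_t F)).
Proof. by move=> f g eq_t; apply: fpsP => n; rewrite -fps_tME eq_t fps_tME. Qed.

Let expm1 : fps F := fps_exp F - 1.

Let expm1_0 : expm1 0%N = 0.
Proof. by rewrite fpsDE fpsNE fps1E /= invr1 subrr. Qed.

Let expm1_1 : expm1 1%N != 0.
Proof. by rewrite fpsDE fpsNE fps1E /= invr1 subr0 oner_eq0. Qed.

Lemma fps_deriv_expm1 : fps_deriv (fps_exp F - 1) = fps_exp F.
Proof.
apply: fpsP => n; rewrite fps_derivE fpsDE fpsNE fps1E subr0 /= factS natrM.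
by rewrite -[LHS]mulr_natr invfM mulrAC mulVf ?mul1r.
Qed.

Lemma fps_deriv_log1p : fps_deriv (fps_log1p F) * (1 + fps_t F) = 1.
Proof.
have dE n : fps_deriv (fps_log1p F) n = (-1) ^+ n.
  by rewrite fps_derivE /= -[LHS]mulr_natr mulfVK.
apply: fpsP => n; rewrite mulrDr mulr1 fpsDE mulrC dE fps1E.
case: n => [|n]; first by rewrite fps_mul0E mul0r addr0.
by rewrite fps_tME dE exprS mulN1r addNr.
Qed.

Lemma fps_log1p_expm1 : fps_comp (fps_log1p F) (fps_exp F - 1) = fps_t F.
Proof.
apply: fps_deriv_inj; first by rewrite /= big_ord_recl big_ord0 /= mul0r addr0.
rewrite fps_deriv_comp // fps_deriv_t fps_deriv_expm1.
(* Writing e^t as 1 + t taken at e^t - 1 puts both factors under one composition, where their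
   product is 1. *)
have {2}-> : fps_exp F = fps_comp (1 + fps_t F) expm1.
  by rewrite fps_compD fps_comp1 fps_comp_t // addrC subrK.
by rewrite -fps_compM // fps_deriv_log1p fps_comp1.
Qed.

(** Substituting e^t - 1 into (t / log(1 + t)) log(1 + t) = t turns the logarithm into t; it remains
    to cancel t. *)
Lemma fps_tdiv_log1p_expm1 :
  fps_comp (fps_tdiv (fps_log1p F)) (fps_exp F - 1) =
  (fps_tdiv (fps_exp F - 1))^-1.
Proof.
apply/esym/mulr1_eq/fps_tI; rewrite mulr1 -[RHS]fps_tdiv_expm1K.
rewrite mulrCA; congr (_ * _); rewrite -[X in X * _]fps_log1p_expm1 mulrC.
by rewrite -fps_compM // fps_tdiv_log1pK fps_comp_t.
Qed.

(** The substitution into the power contributes the exponent -r and the change of variable a + 1;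
    the factor e^t is the derivative of e^t - 1 and accounts for the evaluation of Bernoulli
    polynomials at 1. *)
Lemma fps_tdiv_log1pXzE (r : int) a :
  (fps_tdiv (fps_log1p F) ^ r) a =
  (fps_tdiv (fps_exp F - 1) ^ (a%:Z - r + 1) * fps_exp F) a.
Proof.
have U_tdiv f : f 1%N != 0 -> fps_tdiv f \is a GRing.unit.
  by move=> f1; rewrite unitrV [_ \is a _]unitfE.
rewrite (fps_change_of_variable expm1_0 expm1_1).
rewrite fps_compXz ?U_tdiv //; last first.
  by rewrite /= divr1 oner_eq0.
rewrite fps_tdiv_log1p_expm1 fps_deriv_expm1 mulrCA mulrC exprz_inv.
rewrite (_ : a%:Z - r + 1 = - r + a.+1); last by rewrite intS; ring.
by rewrite (exprzDr (U_tdiv _ expm1_1)).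
Qed.

(** * Coefficient extraction and reordering of the sums *)

Lemma bernoulli_at1 alpha n :
  (bernoulli F alpha n).[1] =
  n`!%:R * (fps_tdiv (fps_exp F - 1) ^ alpha * fps_exp F) n.
Proof.
rewrite /bernoulli !mulr_natl hornerMn !fpsME horner_sum; congr (_ *+ _).
by apply: eq_bigr => i _; rewrite hornerCM hornerZ hornerXn expr1n mulr1.
Qed.

Lemma fps_egfM f g n :
  n`!%:R * (f * g) n =
  \sum_(i < n.+1) 'C(n, i)%:R * (i`!%:R * f i) * ((n - i)`!%:R * g (n - i)%N).
Proof.
rewrite fpsME mulr_sumr; apply: eq_bigr => i _.
have le_in : (i <= n)%N by rewrite -ltnS.
rewrite -(bin_fact le_in) !natrM; ring.
Qed.

Lemma falling_opp n :
  falling (- 'X : {poly F}) n =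
  \sum_(j < n.+1) ((-1) ^+ j * (stirling1 n j)%:~R) *: 'X^j.
Proof.
(* [comp_polyE] sums up to the size of the outer polynomial; this bound lets the sum be extended to
   all j <= n by zero coefficients. *)
have size_falling : (size (falling ('X : {poly int}) n) <= n.+1)%N.
  rewrite /falling (eq_bigr (fun i : 'I_n => 'X - (i%:R)%:P)) => [|i _].
    by rewrite size_prod_XsubC /index_enum -enumT size_enum_ord.
  by rewrite polyC_natr.
have -> : falling (- 'X : {poly F}) n =
  map_poly intr (falling ('X : {poly int}) n) \Po (- 'X).
  rewrite /falling !rmorph_prod; apply: eq_bigr => i _ /=.
  by rewrite !rmorphB !rmorph_nat /= map_polyX comp_polyX.
rewrite comp_polyE (big_ord_widen n.+1
  (fun j => (map_poly intr (falling ('X : {poly int}) n))`_j *: (- 'X) ^+ j)).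
  rewrite big_mkcond; apply: eq_bigr => j _.
  have -> : (- 'X) ^+ j = (-1) ^+ j *: 'X^j :> {poly F}.
    by rewrite [LHS]exprNn -mul_polyC polyC_exp polyCN.
  rewrite scalerA [_ * (-1) ^+ j]mulrC -[(stirling1 n j)%:~R]coef_map.
  by case: ltnP => // le_j; rewrite nth_default // mulr0 scale0r.
exact: leq_trans (size_poly _ _) size_falling.
Qed.

Lemma polyA_expansion (r k : int) n :
  polyA F r k n =
  \sum_(j < n.+1)
    (\sum_(l < (n - j).+1) \sum_(a < (n - l - j).+1)
       (-1) ^+ j * 'C(n, l + j)%:R * 'C(n - l - j, a)%:R
       * (stirling1 (l + j) j)%:~R
       * (bernoulli F (a%:Z - r + 1) a).[1]
       * poly_cauchy F k (n - j - l - a)) *: 'X^j.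
Proof.
pose D := fps_tdiv (fps_log1p F) ^ r.
pose G := fps_comp (fps_Lif F k) (fps_log1p F).
(* Binomial convolution, in which a! [t^a] [D] becomes a Bernoulli value. *)
have coefDG m : m`!%:R * (D * G) m = \sum_(a < m.+1) 'C(m, a)%:R
    * (bernoulli F (a%:Z - r + 1) a).[1] * poly_cauchy F k (m - a).
  rewrite fps_egfM; apply: eq_bigr => a _.
  by rewrite bernoulli_at1 -fps_tdiv_log1pXzE.
(* The binomial series contributes the falling factorial of -x over m!, and n!/m! = C(n,m)
   (n-m)!. *)
have -> : polyA F r k n = \sum_(m < n.+1)
    ('C(n, m)%:R * ((n - m)`!%:R * (D * G) (n - m)%N)) *: falling (- 'X) m.
  rewrite /polyA mulrC [fps_polyC _ * _]mulrC mulrC fpsME mulr_sumr.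
  apply: eq_bigr => m _; have le_mn : (m <= n)%N by rewrite -ltnS.
  have -> : fps_1tX (- 'X) m * fps_polyC (D * G) (n - m)%N =
      ((D * G) (n - m)%N / m`!%:R) *: falling (- 'X : {poly F}) m.
    by rewrite mulrC [LHS]mul_polyC [LHS]scalerA.
  rewrite -polyC_natr mul_polyC scalerA -(bin_fact le_mn) !natrM.
  by congr (_ *: _); field; rewrite fact_neq0.
under eq_bigr => m _ do rewrite falling_opp scaler_sumr.
(* Setting m = l + j makes the exponent j of x the outer index. *)
rewrite (sum_triangle n.+1 (fun m j =>
  ('C(n, m)%:R * ((n - m)`!%:R * (D * G) (n - m)%N)) *:
  (((-1) ^+ j * (stirling1 m j)%:~R) *: 'X^j))).
apply: eq_bigr => j _; rewrite subSn; last by rewrite -ltnS.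
rewrite scaler_suml; apply: eq_bigr => l _; rewrite scalerA; congr (_ *: _).
rewrite coefDG mulr_sumr mulr_suml addnC subnDA subnAC addnC.
by apply: eq_bigr => a _; ring.
Qed.

End LogExp.

Theorem theorem2p2 (R : realType) (r k : int) (n : nat) :
  polyA R[i] r k n =
  \sum_(j < n.+1)
    (\sum_(l < (n - j).+1) \sum_(a < (n - l - j).+1)
       (-1) ^+ j * 'C(n, l + j)%:R * 'C(n - l - j, a)%:R
       * (stirling1 (l + j) j)%:~R
       * (bernoulli R[i] (a%:Z - r + 1) a).[1]
       * poly_cauchy R[i] k (n - j - l - a)) *: 'X^j.
Proof. exact: polyA_expansion. Qed.
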